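(* Let $0<p<q<+\infty$. Then $(H^p\setminus H^q)\cup\{0\}$ contains a vector space dense in $H^p$.
   Context: $D=\{z\in\mathbb{C}:|z|<1\}$. For $0<p<\infty$, $H^p=H^p(D)$ is the Hardy space of holomorphic functions $f$ on $D$ with $\sup_{0<r<1}\int_0^{2\pi}|f(re^{i\theta})|^p\,d\theta<+\infty$, with its usual complete metrizable vector space topology: $f_n\to f$ in $H^p$ iff $\sup_{0<r<1}\int_0^{2\pi}|f_n(re^{i\theta})-f(re^{i\theta})|^p\,d\theta\to0$. Vector spaces are over $\mathbb{C}$. *)

(* Defs.v *)
From HB Require Import structures.
From mathcomp Require Import all_boot all_order all_algebra.
From mathcomp Require Import all_classical all_reals all_analysis.
From mathcomp Require Import measurable_realfun complex.
Set Implicit Arguments.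
Unset Strict Implicit.
Unset Printing Implicit Defensive.
Import Order.TTheory GRing.Theory Num.Theory.
Import numFieldNormedType.Exports.
Local Open Scope classical_set_scope.
Local Open Scope ring_scope.
Local Open Scope complex_scope.

Section hardy.
Variable R : realType.
Local Notation C := (R[i]^o).
Local Notation normc := Normc.normc.

(* sup over 0 < r < 1 of the integral over [0, 2 pi] of |f(r e^(it))|^p. *)
Definition hardy_gauge (p : R) (f : C -> C) : \bar R :=
  ereal_sup [set (\int[lebesgue_measure]_(t in `[0%R, (2 * pi)%R])
                    (normc (f ((r * cos t) +i* (r * sin t))) `^ p)%:E)%E
            | r in [set r : R | 0 < r < 1]].

(* A holomorphic function on the open unit disc is represented by its extension
   by 0 to the whole plane, so that equality of functions on the disc is
   equality of functions C -> C.  [derivable] over the field R[i] is complex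
   differentiability. *)
Definition Hardy (p : R) : set (C -> C) :=
  [set f | [/\ forall z : C, normc z < 1 -> derivable f z (1 : C),
               forall z : C, 1 <= normc z -> f z = 0
             & (hardy_gauge p f < +oo)%E]].

Definition hardy_space (p : R) : Type := set_type (Hardy p).
HB.instance Definition _ p := Choice.copy (hardy_space p) (set_type (Hardy p)).

Definition hardy_ball (p : R) (f : hardy_space p) (e : R) : set (hardy_space p) :=
  [set g | (hardy_gauge p (val g - val f)%R < e%:E)%E].

Definition hardy_open (p : R) : set_system (hardy_space p) :=
  [set U | forall f, U f -> exists2 e : R, 0 < e & hardy_ball f e `<=` U].

Lemma hardy_openT p : @hardy_open p setT.
Proof. by move=> f _; exists 1. Qed.

Lemma hardy_openI p : setI_closed (@hardy_open p).
Proof.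
move=> U W oU oW f [/oU[e e0 eU] /oW[d d0 dW]].
exists (Num.min e d); first by rewrite lt_min e0.
by move=> g; rewrite /hardy_ball/= EFin_min lt_min => /andP[/eU + /dW].
Qed.

Lemma hardy_open_bigU p (I : Type) (U : I -> set (hardy_space p)) :
  (forall i, hardy_open (U i)) -> hardy_open (\bigcup_i U i).
Proof.
by move=> oU f [i _ /oU[e e0 eU]]; exists e => // g /eU ?; exists i.
Qed.

HB.instance Definition _ p := isOpenTopological.Build (hardy_space p)
  (@hardy_openT p) (@hardy_openI p) (@hardy_open_bigU p).

Lemma normcE (z : C) : `|z| = (normc z)%:C.
Proof. by []. Qed.

Lemma normcB_le (x y : C) : normc (x + y) <= normc x + normc y.
Proof.
by have := ler_normD x y; rewrite !normcE -rmorphD/= lecR.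
Qed.

Lemma normc_ge0 (x : C) : 0 <= normc x.
Proof. by case: x => a b; exact: sqrtr_ge0. Qed.

Lemma normc_circle (r t : R) : 0 < r -> normc ((r * cos t) +i* (r * sin t)) = r.
Proof.
move=> r0; rewrite /normc !exprMn -mulrDr cos2Dsin2 mulr1 sqrtr_sqr.
by rewrite gtr0_norm.
Qed.

Lemma circle_continuous (r : R) :
  continuous (fun t : R => (((r * cos t) +i* (r * sin t)) : C)).
Proof.
move=> t; apply/cvgrPdist_lt => /= -[e e'].
rewrite ltcE/= => /andP[/eqP->] e0.
have e20 : 0 < e / 2 by rewrite divr_gt0.
have c1 : r * cos x @[x --> t] --> r * cos t.
  by apply: cvgMr; exact: continuous_cos.
have c2 : r * sin x @[x --> t] --> r * sin t.
  by apply: cvgMr; exact: continuous_sin.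
move/cvgrPdist_lt : c1 => /(_ _ e20) c1.
move/cvgrPdist_lt : c2 => /(_ _ e20) c2.
near=> s.
rewrite normcE ltcR.
have -> : ((r * cos t) +i* (r * sin t) : C) - (r * cos s +i* (r * sin s)) =
  (r * cos t - r * cos s)%:C + (0 +i* (r * sin t - r * sin s)).
  by apply/eqP; rewrite eq_complex/= addr0 add0r !eqxx.
apply: le_lt_trans (normcB_le _ _) _; rewrite (splitr e).
rewrite /= expr0n/= addr0 add0r !sqrtr_sqr ltrD//; near: s.
  exact: c1.
exact: c2.
Unshelve. all: by end_near. Qed.

Lemma normc_cont : continuous (fun z : C => normc z : R).
Proof.
move=> z; apply/(@cvgrPdist_lt _ _ _ (nbhs z) (nbhs_filter z)) => e e0.
have : \forall w \near z, `|z - w| < e%:C.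
  have /cvgrPdist_lt := @cvg_id C (nbhs z).
  by apply; rewrite ltcR.
apply: filterS => w; rewrite normcE ltcR; apply: le_lt_trans.
rewrite ler_norml; apply/andP; split.
  rewrite lerBrDr addrC lerBlDr -(opprB w z) normcN.
  by rewrite [leRHS]addrC -{1}(subrK z w); exact: normcB_le.
by rewrite lerBlDr -{1}(subrK w z); exact: normcB_le.
Qed.

Lemma circle_measurable (g : C -> C) (p r : R) : 0 < r < 1 ->
  (forall z : C, normc z < 1 -> derivable g z (1 : C)) ->
  measurable_fun [set: R]
   (EFin \o (fun t : R => normc (g ((r * cos t) +i* (r * sin t))) `^ p)).
Proof.
move=> /andP[r0 r1] dg.
apply/measurable_EFinP; apply: (measurableT_comp (measurable_powR p)).
apply: continuous_measurable_fun => t.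
pose h := fun t : R => (((r * cos t) +i* (r * sin t)) : C).
apply: (@continuous_comp _ _ _ (g \o h) (fun z : C => normc z : R)); last exact: normc_cont.
apply: (@continuous_comp _ _ _ h g); first exact: circle_continuous.
apply: (@differentiable_continuous _ _ _ (h t) g); apply/derivable1_diffP; apply: dg.
by rewrite /h normc_circle.
Qed.

Lemma powRD_le (p a b : R) : 0 < p -> 0 <= a -> 0 <= b ->
  (a + b) `^ p <= 2 `^ p * (a `^ p + b `^ p).
Proof.
move=> p0 a0 b0; wlog ab : a b a0 b0 / a <= b.
  move=> H; have [/H|/ltW/H] := leP a b; first exact.
  by rewrite addrC [X in _ * X]addrC; exact.
apply: (@le_trans _ _ ((2 * b) `^ p)).
  apply: (ge0_ler_powR (ltW p0)); rewrite ?nnegrE ?addr_ge0 ?mulr_ge0//.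
  by rewrite mulr_natl mulr2n lerD2r.
rewrite powRM// ler_pM2l ?powR_gt0//.
by rewrite lerDr powR_ge0.
Qed.

Lemma hardy_gaugeD (p : R) (f g : C -> C) : 0 < p ->
  (forall z : C, normc z < 1 -> derivable f z (1 : C)) ->
  (forall z : C, normc z < 1 -> derivable g z (1 : C)) ->
  (hardy_gauge p (f + g)%R <= (2 `^ p)%:E * (hardy_gauge p f + hardy_gauge p g))%E.
Proof.
move=> p0 df dg; apply: ge_ereal_sup => _ [r /= r01 <-].
pose D : set R := `[0, 2 * pi]%classic.
have mc (h : C -> C) : (forall z : C, normc z < 1 -> derivable h z (1 : C)) ->
  measurable_fun D (EFin \o (fun t : R => normc (h ((r * cos t) +i* (r * sin t))) `^ p)).
  by move=> dh; apply: measurable_funTS; exact: circle_measurable.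
have mD : measurable D by exact: measurable_itv.
have p2 : (0 <= (2 `^ p)%:E :> \bar R)%E by rewrite lee_fin powR_ge0.
apply: (@le_trans _ _ ((2 `^ p)%:E * (\int[lebesgue_measure]_(t in D)
   ((normc (f ((r * cos t) +i* (r * sin t))) `^ p)%:E + (normc (g ((r * cos t) +i* (r * sin t))) `^ p)%:E)))%E).
  rewrite -ge0_integralZl//; last 2 first.
  - by apply: emeasurable_funD; exact: mc.
  - by move=> t _; rewrite adde_ge0// lee_fin powR_ge0.
  apply: ge0_le_integral => //.
  - by move=> t _; rewrite lee_fin powR_ge0.
  - by apply: (mc (f + g)) => z z1; apply: derivableD; [exact: df|exact: dg].
  - by apply: measurable_funeM; apply: emeasurable_funD; exact: mc.
  - move=> t _; rewrite -EFinD -EFinM lee_fin.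
    apply: le_trans (powRD_le p0 (normc_ge0 _) (normc_ge0 _)).
    apply: (ge0_ler_powR (ltW p0)); rewrite ?nnegrE ?addr_ge0 ?normc_ge0//.
    exact: normcB_le.
apply: lee_wpmul2l => //; rewrite ge0_integralD//; last 4 first.
- by move=> t _; rewrite lee_fin powR_ge0.
- exact: mc.
- by move=> t _; rewrite lee_fin powR_ge0.
- exact: mc.
by apply: leeD; apply: ereal_sup_ubound; exists r.
Qed.

Lemma hardy_gauge_ge0 (p : R) (f : C -> C) : (0 <= hardy_gauge p f)%E.
Proof.
apply: le_trans (ereal_sup_ubound _); last first.
  by exists (2^-1) => //=; rewrite invr_gt0 ltr0n/= invf_lt1 ?ltr1n.
by apply: integral_ge0 => t _; rewrite lee_fin powR_ge0.
Qed.

Lemma hardy_gauge0 (p : R) : 0 < p -> hardy_gauge p (0 : C -> C) = 0%E.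
Proof.
move=> p0; apply/eqP; rewrite eq_le hardy_gauge_ge0 andbT.
apply: ge_ereal_sup => _ [r /= r01 <-].
by rewrite integral0_eq// => t _; rewrite expr0n/= addr0 sqrtr0 powR0// gt_eqF.
Qed.

Lemma hardy_nbhsP (p : R) (f : hardy_space p) (A : set (hardy_space p)) :
  0 < p -> nbhs f A <-> exists2 e : R, 0 < e & hardy_ball f e `<=` A.
Proof.
move=> p0.
have dB (g h : hardy_space p) (z : C) : normc z < 1 -> derivable (val g - val h) z (1 : C).
  move=> z1; have [dg _ _] := set_valP g; have [dh _ _] := set_valP h.
  by apply: derivableB; [exact: dg|exact: dh].
have self (g : hardy_space p) e : 0 < e -> hardy_ball g e g.
  by move=> e0; rewrite /hardy_ball/= subrr hardy_gauge0.
rewrite nbhsE; split.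
  move=> [U [oU /oU[e e0 eU]] UA]; exists e => //.
  by apply: subset_trans UA.
move=> [e e0 eA].
exists [set g | exists2 d, 0 < d & hardy_ball g d `<=` A]; last first.
  by move=> g [d d0]; apply; exact: self.
split; last by exists e.
move=> g [d d0 dA].
have C0 : 0 < 2 `^ p * 2 :> R by rewrite mulr_gt0// powR_gt0.
exists (d / (2 `^ p * 2)); first by rewrite divr_gt0.
move=> h gh; exists (d / (2 `^ p * 2)); first by rewrite divr_gt0.
move=> k hk; apply: dA; rewrite /hardy_ball/=.
rewrite -(subrKA (val h)).
apply: le_lt_trans (hardy_gaugeD p0 (dB _ _) (dB _ _)) _.
rewrite muleC -lte_pdivlMr ?powR_gt0//.
have -> : (d%:E * ((2 `^ p)^-1)%:E = (d / (2 `^ p * 2))%:E + (d / (2 `^ p * 2))%:E :> \bar R)%E.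
  by rewrite -EFinM -EFinD; congr EFin; rewrite invfM mulrA -splitr.
by apply: lteD; [exact: hk|exact: gh].
Qed.

(* Certifies that [hardy_open] is the intended topology: its convergent
   sequences are exactly those with sup_r int |f_n - f|^p --> 0. *)
Lemma hardy_cvgP (p : R) (u : nat -> hardy_space p) (f : hardy_space p) : 0 < p ->
  u @ \oo --> f <-> hardy_gauge p (val (u n) - val f) @[n --> \oo] --> 0%E.
Proof.
move=> p0; split.
  move=> uf; apply/fine_cvgP; split.
    have nb : nbhs f (hardy_ball f 1) by apply/hardy_nbhsP => //; exists 1.
    apply: (@filterS _ \oo _ _ _ _ (uf _ nb)) => n /= h; rewrite ge0_fin_numE ?hardy_gauge_ge0//.
    exact: lt_trans h (ltry _).
  apply/cvgrPdist_lt => e e0.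
  have nb : nbhs f (hardy_ball f e) by apply/hardy_nbhsP => //; exists e.
  apply: (@filterS _ \oo _ _ _ _ (uf _ nb)) => n /= h; rewrite sub0r normrN ger0_norm ?fine_ge0 ?hardy_gauge_ge0//.
  rewrite -lte_fin fineK// ge0_fin_numE ?hardy_gauge_ge0//.
  exact: lt_trans h (ltry _).
move=> /fine_cvgP[fu /cvgrPdist_lt u0] A /(hardy_nbhsP _ _ p0)[e e0 eA].
apply: (@filterS2 _ \oo _ _ _ _ _ fu (u0 e e0)) => n /= fn.
rewrite sub0r normrN ger0_norm ?fine_ge0 ?hardy_gauge_ge0// => une.
by apply: eA; rewrite /hardy_ball/= -(fineK fn) lte_fin.
Qed.

End hardy.

(* Main.v *)
(** No density theorem for H^p is needed, only linear algebra and counting.  The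
functions [g_s(z) = (1 - z)^(-s)], [1/q < s < 1/p], lie in H^p, and a linear
combination of them whose largest exponent has a nonzero coefficient is not in
H^q, because near [z = 1] that exponent dominates.  By Zorn's lemma there is a
subspace [Z] containing H^q which is maximal among those containing no such
combination; maximality forces every function to be the sum of an element of
[Z] and a combination of [g_s] with exponents below some [h < 1/p].

A holomorphic function is determined by countably many values, so H^p has at
most the cardinality of the reals, and there is a map [rho] from ]1/q, 1/p[
taking each value in H^p at points arbitrarily close to [1/p].  Let [V] be
spanned by [f_t + eps_t g_t], where [f_t = rho t] if [rho t] decomposes with
exponents below [t], [f_t = 0] otherwise, and [eps_t] is so small that the
gauge of [eps_t g_t] is less than [1/p - t].  Each [f] in H^p is [f_t] for [t]
arbitrarily close to [1/p], so [V] is dense.  In a nonzero element of [V] the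
term with the largest [t] contributes an exponent that nothing else cancels
modulo [Z], so the element is not in [Z], hence not in H^q. *)
Require Import Defs.
From mathcomp Require Import all_boot all_order all_algebra.
From mathcomp Require Import all_classical all_reals all_analysis.
From mathcomp Require Import measurable_realfun ring lra.
From mathcomp Require Import complex.
Import Order.TTheory GRing.Theory Num.Theory.
Import numFieldNormedType.Exports.
Local Open Scope classical_set_scope.
Local Open Scope ring_scope.

(** ** Leading terms and transversal subspaces *)

Section linear_span.
Context {K : fieldType} {E : lmodType K} {R : realType}.
Implicit Types (g : R -> E) (D : set R) (S Z : set E).

Definition linear_subspace S := S 0 /\ forall k x y, S x -> S y -> S (k *: x + y).

Lemma linear_subspaceD S x y : linear_subspace S -> S x -> S y -> S (x + y).
Proof. by move=> [_ SP] Sx Sy; have := SP 1 x y Sx Sy; rewrite scale1r. Qed.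

Lemma linear_subspaceZ S k x : linear_subspace S -> S x -> S (k *: x).
Proof. by move=> [S0 SP] Sx; have := SP k x 0 Sx S0; rewrite addr0. Qed.

Lemma linear_subspaceB S x y : linear_subspace S -> S x -> S y -> S (x - y).
Proof. by move=> [S0 SP] Sx Sy; rewrite addrC -scaleN1r; apply: SP. Qed.

(** An index may occur several times in the list, so that sums are plain concatenations; equal
    indices are only collected in [lincomb_leading]. *)
Definition lincomb D g : set E :=
  [set u | exists2 l : seq (K * R), {in l, forall x, D x.2}
                                  & u = \sum_(x <- l) x.1 *: g x.2].

Lemma lincomb_subspace D g : linear_subspace (lincomb D g).
Proof.
split; first by exists [::]; rewrite ?big_nil.
move=> k _ _ [l lD ->] [l' l'D ->].
exists ([seq (k * x.1, x.2) | x <- l] ++ l').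
  by move=> x; rewrite mem_cat => /orP[/mapP[y /lD Dy ->]|/l'D].
rewrite big_cat big_map scaler_sumr /=; congr (_ + _).
by apply: eq_bigr => x _; rewrite scalerA.
Qed.

Lemma lincomb_gen D g t : D t -> lincomb D g (g t).
Proof.
move=> Dt; exists [:: (1, t)]; last by rewrite big_seq1 scale1r.
by move=> x; rewrite inE => /eqP ->.
Qed.

Lemma lincombS D D' g : D `<=` D' -> lincomb D g `<=` lincomb D' g.
Proof. by move=> DD' u [l lD ->]; exists l => // x /lD /DD'. Qed.

Lemma lincomb_sub D g S : linear_subspace S -> (forall t, D t -> S (g t)) ->
  lincomb D g `<=` S.
Proof.
move=> SS Sg _ [l + ->]; elim: l => [|x l ih] lD.
  by rewrite big_nil; case: SS.
rewrite big_cons; apply: (proj2 SS); first by apply/Sg/lD; rewrite mem_head.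
by apply: ih => y yl; apply: lD; rewrite in_cons yl orbT.
Qed.

Lemma lincomb_leading D g u : lincomb D g u ->
  u = 0 \/ exists c t w, [/\ c != 0, D t, lincomb (D `&` [set s | s < t]) g w
                         & u = c *: g t + w].
Proof.
move=> [l + ->]; have [n] := ubnP (size l); elim: n l => // n ih l sl lD.
case: l sl lD => [|x0 l0]; first by rewrite big_nil; left.
set l := x0 :: l0 => sl lD.
(* Seeding the maximum with an index of the list itself guarantees that it is attained in the
   list. *)
pose t := \big[Num.max/x0.2]_(x <- l) x.2.
have tP x : x \in l -> x.2 <= t by move=> xl; apply: le_bigmax_seq.
have [y yl yt] : exists2 y, y \in l & y.2 = t.
  rewrite /t big_seq; elim/big_rec: _ => [|y m yl [z zl zm]].
    by exists x0 => //; rewrite mem_head.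
  by rewrite /Num.max; case: ifP => _; [exists z|exists y].
pose l1 := [seq x <- l | x.2 == t]; pose l2 := [seq x <- l | x.2 != t].
have -> : \sum_(x <- l) x.1 *: g x.2 =
    (\sum_(x <- l1) x.1) *: g t + \sum_(x <- l2) x.1 *: g x.2.
  rewrite (bigID (fun x => x.2 == t)) /= !big_filter; congr (_ + _).
  rewrite scaler_suml; apply: eq_bigr => x /eqP ->//.
have l2l : {subset l2 <= l} by move=> x; rewrite mem_filter => /andP[].
have [->|c0] := eqVneq (\sum_(x <- l1) x.1) 0.
  rewrite scale0r add0r; apply: ih; last by move=> x /l2l /lD.
  rewrite -ltnS; apply: leq_trans sl; rewrite ltnS size_filter.
  rewrite -(count_predC (fun x => x.2 == t) l) -add1n leq_add2r -has_count.
  by apply/hasP; exists y => //; rewrite yt.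
right; exists (\sum_(x <- l1) x.1), t, (\sum_(x <- l2) x.1 *: g x.2); split=> //.
  by rewrite -yt; exact: lD.
exists l2 => // x; rewrite mem_filter => /andP[xt xl]; split; first exact: lD.
by rewrite /= lt_neqAle xt tP.
Qed.

End linear_span.

Section transversal.
Context {K : fieldType} {E : lmodType K} {R : realType}.
Variables (g : R -> E) (a b : R).

Let below t : set R := [set s | a < s < t].

Definition span_below (Z : set E) t : set E := [set f |
  exists2 z, Z z & exists2 u, lincomb (below t) g u & f = z + u].

(** For a subspace [Z], which contains 0, this also forces the [g t] with [a < t < b] to be linearly
    independent. *)
Definition no_leading_term (Z : set E) := forall t c u, a < t < b ->
  lincomb (below t) g u -> Z (c *: g t + u) -> c = 0.

(** Let [Z] be maximal and [f] outside it. Adjoining [f] creates a relation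
    [c *: g t + u = z + k *: f] with [c] nonzero. Here [k] is nonzero too, as [Z] has no leading
    term, so [f] can be solved for in terms of [Z] and indices at most [t]. *)
Lemma transversal_exists (Y : set E) : a < b -> linear_subspace Y -> no_leading_term Y ->
  exists Z, [/\ linear_subspace Z, Y `<=` Z, no_leading_term Z &
    forall f, exists2 h, h < b & forall t, h < t -> span_below Z t f].
Proof.
move=> ab subY indY.
(* Zorn's lemma is applied to [A] with [A `|` Y] in place of [A], so that the
   union of the empty chain is admissible. *)
pose good (A : set E) := linear_subspace (A `|` Y) /\ no_leading_term (A `|` Y).
have [|A [[subA indA] maxA]] := @Zorn_bigcup E good.
  move=> F Fgood Ftot; have [->|/set0P[A0 FA0]] := eqVneq F set0.
    by rewrite /good bigcup_set0 set0U.
  have UE x : (\bigcup_(A in F) A `|` Y) x <-> exists2 A, F A & (A `|` Y) x.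
    split=> [[[A FA Ax]|Yx]|[A FA [Ax|Yx]]].
    - by exists A => //; left.
    - by exists A0 => //; right.
    - by left; exists A.
    - by right.
  split; [split=> [|k x y /UE[A FA Ax] /UE[B FB By]]|].
  - by apply/UE; exists A0 => //; have [[]] := Fgood _ FA0.
  - apply/UE; have [AB|BA] := Ftot _ _ FA FB.
      exists B => //; have [[_ BP] _] := Fgood _ FB; apply: BP => //.
      by case: Ax => [/AB|]; [left|right].
    exists A => //; have [[_ AP] _] := Fgood _ FA; apply: AP => //.
    by case: By => [/BA|]; [left|right].
  - move=> t c u tab ut /UE[A FA]; have [_] := Fgood _ FA; exact.
pose Z := A `|` Y.
exists Z; split=> // [x Yx|f]; first by right.
have [Zf|nZf] := pselect (Z f).
  exists a => // t _; exists f => //; exists 0; last by rewrite addr0.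
  exact: (proj1 (lincomb_subspace _ _)).
pose B := [set x | exists k, exists2 z, Z z & x = z + k *: f].
have ZB : Z `<=` B by move=> x Zx; exists 0, x; rewrite // scale0r addr0.
have BY : B `|` Y = B.
  by apply/seteqP; split=> [x [//|Yx]|x Bx]; [apply: ZB; right|left].
(* [B] is [Z] with [f] adjoined; it strictly contains [A], so maximality applies. *)
have : ~ good B.
  apply: maxA; split=> [x Ax|BA]; first by apply: ZB; left.
  apply: nZf; left; apply: BA; exists 1, 0; last by rewrite scale1r add0r.
  by case: subA.
rewrite /good BY => ngood.
have subB : linear_subspace B.
  split; first by apply: ZB; case: subA.
  move=> k _ _ [i [x Zx ->]] [j [y Zy ->]]; exists (k * i + j), (k *: x + y).
    by case: subA => _; apply.
  by rewrite scalerDr scalerDl scalerA addrACA.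
have : ~ no_leading_term B by move=> indB; apply: ngood.
rewrite /no_leading_term => /existsNP[t] /existsNP[c] /existsNP[u].
move=> /not_implyP[tab] /not_implyP[ut] /not_implyP[[k [z Zz zE]]] c0.
have k0 : k != 0.
  apply: contra_notN c0 => /eqP k0; apply: (indA t c u tab ut).
  by rewrite zE k0 scale0r addr0.
(* The index of the leading term is itself a bound for the indices needed to express [f]. *)
exists t => [|t' tt']; first by case/andP: tab.
exists (- k^-1 *: z); first exact: linear_subspaceZ.
exists (k^-1 *: (c *: g t + u)).
  apply: (linear_subspaceZ _ _ _ (lincomb_subspace _ _)).
  apply: (proj2 (lincomb_subspace _ _)).
    by apply: lincomb_gen; case/andP: tab => at_ _; rewrite /below /= at_.
  by apply: lincombS ut => s /andP[as_ st]; rewrite /below /= as_ (lt_trans st).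
by rewrite zE scalerDr addrA -scalerDl addNr scale0r add0r scalerA mulVf ?scale1r.
Qed.

Lemma span_below_subspace Z t : linear_subspace Z -> linear_subspace (span_below Z t).
Proof.
move=> subZ; have [l0 lP] := lincomb_subspace (below t) g; split.
  by exists 0; [case: subZ|exists 0 => //; rewrite addr0].
move=> k _ _ [x Zx [u lu ->]] [y Zy [v lv ->]].
exists (k *: x + y); first by case: subZ => _; apply.
by exists (k *: u + v); [exact: lP|rewrite scalerDr addrACA].
Qed.

Lemma span_below_gen Z s t : linear_subspace Z -> a < s < t -> span_below Z t (g s).
Proof.
move=> [Z0 _] ast; exists 0 => //; exists (g s); last by rewrite add0r.
exact: lincomb_gen.
Qed.

Lemma span_belowS Z s t : s <= t -> span_below Z s `<=` span_below Z t.
Proof.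
move=> st _ [z Zz [u lu ->]]; exists z => //; exists u => //.
by apply: lincombS lu => r /andP[ar rs]; rewrite /below /= ar (lt_le_trans rs).
Qed.

(** Modulo [Z], both [base t] and all terms of index below [t] are combinations of the [g s] with
    [s < t]. A leading term [c *: (base t + eps t *: g t)] therefore leaves the coefficient
    [c * eps t] on [g t], which would have to vanish if [v] were in [Z]. *)
Lemma perturbed_lincomb_trivial Z (base : R -> E) (eps : R -> K) v :
  linear_subspace Z -> no_leading_term Z ->
  (forall t, span_below Z t (base t)) -> (forall t, a < t < b -> eps t != 0) ->
  lincomb [set t | a < t < b] (fun t => base t + eps t *: g t) v -> Z v -> v = 0.
Proof.
move=> subZ indZ baseP eps0 /lincomb_leading[//|[c [t [w [c0 tab lw ->]]]]] Zv.
have subW := span_below_subspace _ t subZ.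
have Ww : span_below Z t w.
  apply: (lincomb_sub _ _ _ subW) lw => s [/andP[as_ sb] /= st].
  apply: linear_subspaceD => //; first exact: span_belowS (ltW st) _ (baseP s).
  by apply: linear_subspaceZ => //; apply: span_below_gen => //; rewrite as_.
have [z Zz [u lu zu]] : span_below Z t (c *: base t + w).
  by apply: linear_subspaceD => //; exact: linear_subspaceZ.
have /eqP : c * eps t = 0.
  apply: (indZ t _ u tab lu).
  have -> : (c * eps t) *: g t + u = c *: (base t + eps t *: g t) + w - z.
    rewrite scalerDr scalerA [X in _ = X - z]addrAC zu.
    by rewrite -(addrA z) [z + _]addrC addrK addrC.
  exact: linear_subspaceB.
by rewrite mulf_eq0 (negbTE c0) (negbTE (eps0 t tab)).
Qed.

End transversal.

(** ** Enumerating holomorphic functions by reals *)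

Section continuum.
Context {R : realType}.

(** Base 3 with digits 0 and 1 only: the digits after a place add up to at most half a unit of that
    place, so no real has two such expansions. *)
Definition ternary_sum (A : set nat) n : R := \sum_(k < n) (`[< A k >])%:R * 3^-1 ^+ k.

Lemma ternary_sum_le A m n : (m <= n)%N -> ternary_sum A m <= ternary_sum A n.
Proof.
elim: n => [|n ih]; first by rewrite leqn0 => /eqP ->.
rewrite leq_eqVlt => /orP[/eqP -> //|/ih]; move/le_trans; apply.
by rewrite /ternary_sum big_ord_recr /= lerDl mulr_ge0 ?exprn_ge0 ?invr_ge0 ?ler0n.
Qed.

(** The right-hand side adds the geometric sum that arises when all digits from [m] on are 1. *)
Lemma ternary_sum_tail A m k :
  ternary_sum A (m + k) <= ternary_sum A m + 3 / 2 * (3^-1 ^+ m - 3^-1 ^+ (m + k)).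
Proof.
elim: k => [|k ih]; first by rewrite addn0 subrr mulr0 addr0.
rewrite addnS /ternary_sum big_ord_recr /= -/(ternary_sum A (m + k)).
set x := 3^-1 ^+ (m + k) in ih *; have x0 : 0 <= x by rewrite exprn_ge0 ?invr_ge0.
rewrite exprS -/x.
have : (`[< A (m + k)%N >])%:R * x <= x by rewrite ler_piMl// lern1 leq_b1.
rewrite -/(ternary_sum A m); set u := _ * x; set v := ternary_sum A m in ih *.
set w := 3^-1 ^+ m in ih *; lra.
Qed.

Lemma ternary_sum_ub A n : ternary_sum A n <= 3 / 2.
Proof.
have := ternary_sum_tail A 0 n; rewrite add0n /ternary_sum big_ord0 expr0.
have : 0 <= (3^-1 : R) ^+ n by rewrite exprn_ge0 ?invr_ge0.
set x := _ ^+ n; set s := \sum_(_ < _) _; lra.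
Qed.

Definition ternary (A : set nat) : R := sup (range (ternary_sum A)).

(** Compare at the first index [n] where the sets differ: the set containing [n] gains [3^-n] there,
    while the later digits of the other one recover at most half of that. *)
Lemma ternary_inj : injective ternary.
Proof.
have has_supA A : has_sup (range (ternary_sum A)).
  split; first by exists (ternary_sum A 0), 0%N.
  by exists (3 / 2) => _ [n _ <-]; exact: ternary_sum_ub.
have lt_ternary (A B : set nat) n : (forall k, (k < n)%N -> A k <-> B k) ->
    A n -> ~ B n -> ternary B < ternary A.
  move=> AB An Bn; set x : R := 3^-1 ^+ n.
  have x0 : 0 < x by rewrite exprn_gt0 // invr_gt0.
  have sAB : ternary_sum A n = ternary_sum B n.
    apply: eq_bigr => k _; congr (_%:R * _).
    by congr nat_of_bool; apply: asbool_equiv_eq; apply: AB.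
  have lA : ternary_sum A n + x <= ternary A.
    apply: (@le_trans _ _ (ternary_sum A n.+1)); last first.
      by apply: (ub_le_sup (proj2 (has_supA A))); exists n.+1.
    by rewrite {2}/ternary_sum big_ord_recr /= (asboolT An) mul1r.
  apply: lt_le_trans lA; rewrite sAB.
  apply: (@le_lt_trans _ _ (ternary_sum B n + x / 2)); last by lra.
  apply: ge_sup; first by case: (has_supA B).
  move=> _ [m _ <-]; have [mn|nm] := leqP m n.
    by apply: (le_trans (ternary_sum_le B _ _ mn)); rewrite lerDl; lra.
  have := ternary_sum_tail B n.+1 (m - n.+1); rewrite subnKC //.
  rewrite {2}/ternary_sum big_ord_recr /= (asboolF Bn) mul0r addr0 -/(ternary_sum B n).
  rewrite exprS -/x; have : 0 <= (3^-1 : R) ^+ m by rewrite exprn_ge0 ?invr_ge0.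
  set y := _ ^+ m; set u := ternary_sum B m; set v := ternary_sum B n; lra.
move=> A B AB; apply: contrapT => nAB.
have ex : exists n, `[< ~ (A n <-> B n) >].
  apply: contrapT => /forallNP h; apply: nAB; apply/funext => n.
  by apply/propext; apply: contrapT => nn; apply: (h n); apply/asboolP.
case: (ex_minnP ex) => n /asboolP nn minn.
have AB' k : (k < n)%N -> A k <-> B k.
  by move=> kn; apply: contrapT => h; have := minn k (asboolT h); rewrite leqNgt kn.
have [An|nAn] := pselect (A n).
  have nBn : ~ B n by move=> Bn; apply: nn.
  by have := lt_ternary _ _ _ AB' An nBn; rewrite AB ltxx.
have Bn : B n by apply: contrapT => nBn; apply: nn.
have := lt_ternary B A n _ Bn nAn; rewrite AB ltxx => h.
by have := h (fun k kn => iff_sym (AB' k kn)).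
Qed.

Lemma near_sup_recurrent (a b : R) : a < b -> exists rho : R -> R,
  forall x h, h < b -> exists2 t, a < t < b /\ h < t & rho t = x.
Proof.
(* As [t] tends to [b], [(b - t)^-1] runs through infinitely many periods of
   [tan], each of which attains every real value. *)
move=> ab; exists (fun t => tan (b - t)^-1) => x h hb.
pose m := Num.max a h; have mb : m < b by rewrite gt_max ab.
(* Since [atan x] exceeds [- (pi / 2)] and [pi] exceeds 1, this many periods bring [y] beyond
   [(b - m)^-1], that is, [b - y^-1] beyond [m]. *)
pose n := (Num.trunc (pi / 2 + (b - m)^-1)).+1.
pose y := atan x + pi *+ n.
have tany : tan y = x.
  rewrite {}/y; elim: (n) => [|k ih]; first by rewrite addr0 atanK.
  by rewrite mulrSr addrA tanDpi.
have bm0 : 0 < (b - m)^-1 by rewrite invr_gt0 subr_gt0.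
have ny : (b - m)^-1 < y.
  have n1 : pi / 2 + (b - m)^-1 < n%:R by exact: truncnS_gt.
  have n2 : n%:R <= pi *+ n :> R.
    by rewrite lerMn2r; apply/orP; right; have := @pi_ge2 R; lra.
  have := atan_gtNpi2 x; rewrite /y; lra.
exists (b - y^-1); last by rewrite opprB addrC subrK invrK.
have y0 : 0 < y by exact: lt_trans bm0 ny.
have : m < b - y^-1.
  by rewrite ltrBrDr -ltrBrDl invf_plt ?posrE // subr_gt0.
by rewrite gt_max => /andP[-> ->]; rewrite ltrBlDr ltrDl invr_gt0 y0.
Qed.

End continuum.

(** * Neighbourhoods with real radii, and coding of functions by rational cuts *)

Section complex_nbhs.
Local Open Scope complex_scope.
Context {R : realType}.
Local Notation C := (R[i]^o).
Local Notation normc := Normc.normc.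

Lemma normc_leD (x y : R) : normc (x +i* y) <= `|x| + `|y|.
Proof.
have := @normcB_le R (x +i* 0) (0 +i* y).
by rewrite /= !addr0 !add0r expr0n /= addr0 add0r !sqrtr_sqr; apply.
Qed.

(** Balls of [C] have their radii in [R[i]], where being positive means being a positive real; this
    converts them to radii in [R]. *)
Lemma nbhs_normcP (z : C) (P : set C) :
  (\forall w \near z, P w) <->
  exists2 e : R, 0 < e & forall w : C, normc (w - z) < e -> P w.
Proof.
split=> [/nbhs_ballP[[e e'] /=]|[e e0 eP]].
  rewrite ltcE /= => /andP[/eqP -> e0] eP; exists e => // w wz; apply: eP.
  by rewrite -ball_normE /= distrC Defs.normcE ltcR.
apply/nbhs_ballP; exists e%:C; first by rewrite /= ltcR.
by move=> w; rewrite -ball_normE /= distrC Defs.normcE ltcR; exact: eP.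
Qed.

Lemma cvg_normcP (f : C -> C) (z l : C) :
  f w @[w --> z] --> l <->
  forall e : R, 0 < e -> \forall w \near z, normc (f w - l) < e.
Proof.
apply: (iff_trans (@cvgrPdist_lt _ _ _ (nbhs z) (nbhs_filter z) f l)).
split=> [fl e e0|fl [e e']].
  have := fl e%:C; rewrite ltcR => /(_ e0); apply: filterS => w.
  by rewrite distrC Defs.normcE ltcR.
rewrite ltcE /= => /andP[/eqP -> e0].
by apply: filterS (fl _ e0) => w; rewrite distrC Defs.normcE ltcR.
Qed.

(** The boolean lets a single countable type index the cuts of both coordinates. *)
Definition part (im : bool) (z : C) : R :=
  if im then complex.Im z else complex.Re z.

(* A function is coded by the Dedekind cuts of the real and imaginary parts of
   its values at the points with rational coordinates. *)
Definition rational_cuts (f : C -> C) : set nat := [set n |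
  if unpickle n is Some (x, y, r, im) then
    ratr r < part im (f (ratr x +i* ratr y))
  else false].

Lemma eq_rational_cuts (f g : C -> C) (x y : rat) :
  rational_cuts f = rational_cuts g ->
  f (ratr x +i* ratr y) = g (ratr x +i* ratr y).
Proof.
move=> fg.
have cut (u v : R) : (forall r : rat, ratr r < u -> ratr r < v) -> u <= v.
  move=> uv; rewrite leNgt; apply/negP => vu; have [r] := rat_in_itvoo vu.
  by rewrite in_itv /= => /andP[vr /uv rv]; have := lt_trans vr rv; rewrite ltxx.
have cutE r im : (ratr r < part im (f (ratr x +i* ratr y)))
    <-> (ratr r < part im (g (ratr x +i* ratr y))).
  have key n : rational_cuts f n = rational_cuts g n by rewrite fg.
  by have := key (pickle (x, y, r, im)); rewrite /rational_cuts /mkset pickleK => ->.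
apply/eqP; rewrite eq_complex; apply/andP; split; apply/eqP/le_anti/andP; split;
  apply: cut => r; [have [h _] := cutE r false|have [_ h] := cutE r false
    |have [h _] := cutE r true|have [_ h] := cutE r true]; exact: h.
Qed.

(** The two functions agree at rational points arbitrarily close to [z], and both are continuous
    there. *)
Lemma rational_cuts_inj (f g : C -> C) z :
  {for z, continuous f} -> {for z, continuous g} ->
  rational_cuts f = rational_cuts g -> f z = g z.
Proof.
move=> cf cg fg; apply/eqP; rewrite -subr_eq0; apply/eqP/Normc.eq0_normc.
apply/eqP; rewrite eq_le normc_ge0 andbT.
apply/ler_addgt0Pl => e e0; rewrite addr0.
have e20 : 0 < e / 2 by rewrite divr_gt0.
have nfg := @filterI _ (nbhs z) (nbhs_filter z) _ _
  ((cvg_normcP _ _ _).1 cf _ e20)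
  ((cvg_normcP _ _ _).1 cg _ e20).
have [d d0 dfg] := (nbhs_normcP _ _).1 nfg.
have near_rat (u : R) : exists r : rat, `|ratr r - u| < d / 2.
  have ud : u < u + d / 2 by rewrite ltrDl divr_gt0.
  have [r] := rat_in_itvoo ud; rewrite in_itv /= => /andP[ur rd].
  by exists r; rewrite gtr0_norm ?subr_gt0 // ltrBlDl.
have [x xz] := near_rat (complex.Re z); have [y yz] := near_rat (complex.Im z).
have [] := dfg (ratr x +i* ratr y).
  case: z xz yz {cf cg nfg dfg} => u v /= xz yz.
  by apply: le_lt_trans (normc_leD _ _) _; rewrite [d]splitr ltrD.
rewrite /= (eq_rational_cuts _ _ _ _ fg); set w := g _.
rewrite -normcN opprB => h1 h2.
rewrite -(subrKA w); apply: le_trans (normcB_le _ _) _.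
by rewrite [e]splitr ltW // ltrD.
Qed.

Lemma holomorphic_continuous (f : C -> C) z :
  derivable f z (1 : C) -> {for z, continuous f}.
Proof. by move=> /derivable1_diffP; apply: differentiable_continuous. Qed.

Lemma hardy_enumeration (p a b : R) : a < b -> exists rho : R -> C -> C,
  forall f h, Hardy p f -> h < b -> exists2 t, a < t < b /\ h < t & rho t = f.
Proof.
move=> ab; have [rho0 rho0P] := near_sup_recurrent a b ab.
pose code (f : C -> C) : R := ternary (rational_cuts f).
(* The code is injective on H^p, so at most one function qualifies; the value 0 is used when there
   is none. *)
pose rho t := xget (0 : C -> C) [set f | Hardy p f /\ code f = rho0 t].
exists rho => f h Hf hb; have [t tP tf] := rho0P (code f) h hb.
exists t => //; rewrite /rho tf; case: xgetP => [g _ [Hg /ternary_inj gf]|]; last first.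
  by move=> /(_ f) [].
case: Hf => df f0 _; case: Hg => dg g0 _; apply/funext => z.
(* Continuity is only available inside the disc; elsewhere both functions are 0 by convention. *)
have [z1|z1] := ltP (normc z) 1; last by rewrite f0 ?g0.
by apply: rational_cuts_inj gf; apply: holomorphic_continuous; [exact: dg|exact: df].
Qed.

End complex_nbhs.

(** ** Complex powers on the right half-plane *)

Section complex_power.
Local Open Scope complex_scope.
Context {R : realType}.
Local Notation C := (R[i]^o).
Local Notation normc := Normc.normc.

Lemma is_derive_linear_approx (f : R -> R) (l e : R) :
  is_derive (0 : R) 1 f l -> 0 < e ->
  exists2 d, 0 < d & forall h, `|h| < d -> `|f h - f 0 - l * h| <= e * `|h|.
Proof.
move=> fl e0.
have /cvgrPdist_lt /(_ e e0) : h^-1 *: (f (h *: 1 + 0) - f 0) @[h --> 0^'] --> l.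
  have [df <-] := fl; exact: df.
rewrite near_withinE => /nbhs_ballP[d /= d0 dP]; exists d => // h hd.
have [->|h0] := eqVneq h 0; first by rewrite subrr mulr0 subr0 normr0 mulr0.
have := dP h; rewrite /ball /= sub0r normrN => /(_ hd h0) /ltW.
rewrite addr0 /GRing.scale /= mulr1 => he.
have -> : f h - f 0 - l * h = - (l - h^-1 * (f h - f 0)) * h.
  by field.
by rewrite normrM normrN ler_pM2r ?normr_gt0.
Qed.

Lemma normc_gt0 (z : C) : z != 0 -> 0 < normc z.
Proof.
move=> z0; rewrite lt_neqAle normc_ge0 eq_sym andbT.
by apply: contraNN z0 => /eqP/Normc.eq0_normc ->.
Qed.

(** Clearing the denominator of the difference quotient gives a real inequality that also makes
    sense at [h = 0]. *)
Lemma derivable_normc (f : C -> C) (z l : C) :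
  (forall e : R, 0 < e -> \forall h \near (0 : C),
     normc (f (h + z) - f z - l * h) <= e * normc h) ->
  derivable f z (1 : C).
Proof.
move=> fl; apply/cvg_ex; exists l.
apply/cvgrPdist_le => -[e e']; rewrite ltcE /= => /andP[/eqP -> e0].
rewrite near_withinE; apply: filterS (fl e e0) => h hP h0.
have hE : l - h^-1 *: (f (h *: (1 : C) + z) - f z) =
    - (h^-1 * (f (h + z) - f z - l * h)).
  rewrite /GRing.scale /= mulr1.
  by rewrite [in RHS]mulrBr [l * h]mulrC mulrA mulVf // mul1r opprB.
rewrite hE Defs.normcE lecR normcN Normc.normcM.
have nh : 0 < normc h by exact: normc_gt0.
rewrite Normc.normcV.
by rewrite mulrC ler_pdivrMr.
Qed.

Lemma Re_le_normc (z : C) : `|complex.Re z| <= normc z.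
Proof.
by case: z => x y /=; rewrite -sqrtr_sqr ler_sqrt ?addr_ge0 ?sqr_ge0 // lerDl sqr_ge0.
Qed.

Lemma Im_le_normc (z : C) : `|complex.Im z| <= normc z.
Proof.
by case: z => x y /=; rewrite -sqrtr_sqr ler_sqrt ?addr_ge0 ?sqr_ge0 // lerDr sqr_ge0.
Qed.

Definition cexp (z : C) : C :=
  (expR (complex.Re z) * cos (complex.Im z)) +i*
  (expR (complex.Re z) * sin (complex.Im z)).

Lemma cexpD (z w : C) : cexp (z + w) = cexp z * cexp w.
Proof.
case: z w => [x y] [u v]; apply/eqP.
by rewrite eq_complex /= expRD cosD sinD; apply/andP; split; apply/eqP; ring.
Qed.

Lemma normc_cexp (z : C) : normc (cexp z) = expR (complex.Re z).
Proof. exact: normc_circle (expR_gt0 _). Qed.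

Lemma cexp_linear_approx (e : R) : 0 < e ->
  \forall h \near (0 : C), normc (cexp h - 1 - h) <= e * normc h.
Proof.
(* With [N = normc h], the four error terms below are at most 1, 2, 4 and 1 times [e1 * N], hence
   the 8; [e1 <= 1] keeps [1 + x] at most 2. *)
move=> e0; have [e1 e10 [e11 e18]] : exists2 e1 : R, 0 < e1 & e1 <= 1 /\ e1 <= e / 8.
  by exists (Num.min 1 (e / 8)); rewrite ?lt_min ?ltr01 ?divr_gt0 // !ge_min !lexx orbT.
have [d1 d10 d1P] := is_derive_linear_approx expR (expR 0) _ (is_derive_expR 0) e10.
have [d2 d20 d2P] := is_derive_linear_approx cos _ _ (is_derive_cos 0) e10.
have [d3 d30 d3P] := is_derive_linear_approx sin _ _ (is_derive_sin 0) e10.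
apply/nbhs_normcP; exists (Num.min (Num.min e1 d1) (Num.min d2 d3)).
  by rewrite !lt_min e10 d10 d20.
move=> h; rewrite subr0 !lt_min => /andP[/andP[he hd1] /andP[hd2 hd3]].
have hx := Re_le_normc h; have hy := Im_le_normc h.
case: h he hd1 hd2 hd3 hx hy => x y he hd1 hd2 hd3 hx hy.
set N := normc _ in he hd1 hd2 hd3 hx hy *; rewrite /= in hx hy.
have := d1P x (le_lt_trans hx hd1); rewrite expR0 mul1r => ex.
have := d2P y (le_lt_trans hy hd2); rewrite cos0 sin0 oppr0 mul0r subr0 => cy.
have := d3P y (le_lt_trans hy hd3); rewrite cos0 sin0 mul1r subr0 => sy.
have -> : cexp (x +i* y) - 1 - (x +i* y) =
    ((expR x - 1 - x) * cos y + (1 + x) * (cos y - 1)) +i*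
    ((expR x - 1) * sin y + (sin y - y)).
  by apply/eqP; rewrite eq_complex /cexp /=; apply/andP; split; apply/eqP; ring.
apply: le_trans (normc_leD _ _) _.
have x1 : `|x| <= e1 by apply: ltW (le_lt_trans hx he).
have b1 : `|(expR x - 1 - x) * cos y| <= e1 * N.
  rewrite normrM -[leRHS]mulr1 ler_pM // ?cos_max //.
  by rewrite (le_trans ex) // ler_pM2l.
have b2 : `|(1 + x) * (cos y - 1)| <= 2 * (e1 * N).
  rewrite normrM ler_pM // ?(le_trans cy) ?ler_pM2l //.
  by rewrite (le_trans (ler_normD _ _)) // normr1; lra.
have N0 : 0 <= N by exact: normc_ge0.
have eN : 0 <= e1 * N by rewrite mulr_ge0 // ltW.
have e1N : e1 * N <= N by rewrite ler_piMl.
have b3 : `|sin y - y| <= e1 * N by rewrite (le_trans sy) // ler_pM2l.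
have b4 : `|expR x - 1| <= 2 * e1.
  rewrite -[expR x - 1](subrK x) (le_trans (ler_normD _ _)) //.
  have : e1 * `|x| <= `|x| by rewrite ler_piMl.
  lra.
have b5 : `|sin y| <= 2 * N.
  by rewrite -[sin y](subrK y) (le_trans (ler_normD _ _)) //; lra.
have b6 : `|(expR x - 1) * sin y| <= 4 * (e1 * N).
  have -> : 4 * (e1 * N) = (2 * e1) * (2 * N) by ring.
  by rewrite normrM ler_pM.
have : 8 * (e1 * N) <= e * N by rewrite mulrA ler_wpM2r // mulrC -ler_pdivlMr.
have := ler_normD ((expR x - 1 - x) * cos y) ((1 + x) * (cos y - 1)).
have := ler_normD ((expR x - 1) * sin y) (sin y - y).
lra.
Qed.

Lemma derivable_cexp (z : C) : derivable cexp z (1 : C).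
Proof.
apply: (@derivable_normc _ _ (cexp z)) => e e0.
have nz : 0 < normc (cexp z) by rewrite normc_cexp expR_gt0.
have := cexp_linear_approx _ (divr_gt0 e0 nz); apply: filterS => h hP.
have -> : cexp (h + z) - cexp z - cexp z * h = cexp z * (cexp h - 1 - h).
  by rewrite cexpD !mulrBr mulr1 [cexp h * _]mulrC.
by rewrite Normc.normcM mulrC -ler_pdivlMr // mulrAC.
Qed.

(** On the right half-plane this is the principal logarithm, the argument being the arctangent of
    the slope. *)
Definition clog (w : C) : C := ln (normc w) +i* atan (complex.Im w / complex.Re w).

Lemma clogK (w : C) : 0 < complex.Re w -> cexp (clog w) = w.
Proof.
case: w => x y /= x0.
have xy : 0 < x ^+ 2 + y ^+ 2 by rewrite ltr_wpDr ?sqr_ge0 // exprn_gt0.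
have n0 : 0 < Num.sqrt (x ^+ 2 + y ^+ 2) by rewrite sqrtr_gt0.
rewrite /cexp /clog /= lnK ?posrE //.
set s := Num.sqrt _ in n0 *.
have sE : s ^+ 2 = x ^+ 2 + y ^+ 2 by rewrite sqr_sqrtr // ltW.
have ca0 : 0 < cos (atan (y / x)) by rewrite cos_gt0_pihalf ?atan_gtNpi2 ?atan_ltpi2.
have ta : sin (atan (y / x)) = y / x * cos (atan (y / x)).
  by apply: canRL (divfK (lt0r_neq0 ca0)) _; exact: atanK (y / x).
have ca : s * cos (atan (y / x)) = x.
  (* Both sides are nonnegative, so it suffices to compare squares, using
     [cos ^+ 2 * (1 + (y / x) ^+ 2) = 1] at [atan (y / x)]. *)
  apply/eqP; rewrite -(@eqrXn2 _ 2) ?mulr_ge0 ?ltW //.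
  have := cos2Dsin2 (atan (y / x)); rewrite ta.
  set c := cos _ in ca0 ta * => h; rewrite exprMn sE.
  rewrite -[X in _ == X]mulr1 -h; apply/eqP; field; exact: lt0r_neq0.
by rewrite ca ta mulrCA ca divfK ?gt_eqF.
Qed.

Lemma cvg_complex (f g : C -> R) (z : C) (x y : R) :
  f w @[w --> z] --> x -> g w @[w --> z] --> y ->
  (f w +i* g w : C) @[w --> z] --> (x +i* y : C).
Proof.
move=> /(@cvgrPdist_lt _ _ _ (nbhs z) (nbhs_filter z)) fx.
move=> /(@cvgrPdist_lt _ _ _ (nbhs z) (nbhs_filter z)) gy.
apply/cvg_normcP => e e0; have e20 : 0 < e / 2 by rewrite divr_gt0.
apply: filterS2 (fx _ e20) (gy _ e20) => w fw gw.
have -> : (f w +i* g w : C) - (x +i* y) = (f w - x) +i* (g w - y) by [].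
by apply: le_lt_trans (normc_leD _ _) _; rewrite [e]splitr ltrD // distrC.
Qed.

Lemma continuous_part im : continuous (part im : C -> R).
Proof.
move=> z; apply/(@cvgrPdist_lt _ _ _ (nbhs z) (nbhs_filter z)) => e e0.
apply/nbhs_normcP; exists e => // w wz.
rewrite distrC; apply: le_lt_trans wz; case: im; case: z w => [x y] [u v].
  exact: (Im_le_normc ((u +i* v) - (x +i* y))).
exact: (Re_le_normc ((u +i* v) - (x +i* y))).
Qed.

Lemma continuous_clog (w : C) : 0 < complex.Re w -> {for w, continuous clog}.
Proof.
move=> w0; apply: cvg_complex.
  apply: (@continuous_comp _ _ _ (fun w : C => normc w : R) (@ln R)).
    exact: normc_cont.
  apply: continuous_ln.
  by apply: lt_le_trans w0 (le_trans (ler_norm _) (Re_le_normc w)).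
apply: (@continuous_comp _ _ _ (fun w : C => complex.Im w / complex.Re w) atan).
  apply: (@cvgM _ _ (nbhs w) (nbhs_filter w)); first exact: (continuous_part true w).
  apply: (@cvgV _ _ (nbhs w) (nbhs_filter w)); first exact: lt0r_neq0.
  exact: (continuous_part false w).
exact: continuous_atan.
Qed.

(** Inverse function argument: for [k = clog v - clog w] one has [cexp k = v / w], and [k] is small
    by continuity, so the expansion of [cexp] at 0 gives [k] as [(v - w) / w] up to a small multiple
    of [k]. *)
Lemma derivable_clog (w : C) : 0 < complex.Re w -> derivable clog w (1 : C).
Proof.
move=> w0; have nw : 0 < normc w.
  by apply: lt_le_trans w0 (le_trans (ler_norm _) (Re_le_normc w)).
have wn0 : w != 0 by apply: contraTneq w0 => ->; rewrite ltxx.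
apply: (@derivable_normc _ _ w^-1) => e e0.
(* The first bound lets the error [d * normc k] be absorbed, so that [k] is at most twice
   [(v - w) / w] in modulus; the second turns the resulting factor [d * 2 / normc w] into at most
   [e]. *)
have [d d0 [d1 d2]] : exists2 d : R, 0 < d & d <= 2^-1 /\ d <= e * normc w / 2.
  exists (Num.min 2^-1 (e * normc w / 2)).
    by rewrite lt_min invr_gt0 ltr0n divr_gt0 ?mulr_gt0.
  by rewrite !ge_min !lexx orbT.
have shift0 (P : C -> Prop) :
    (\forall h \near w, P (h - w)) -> \forall h \near (0 : C), P h.
  move=> /nbhs_normcP[r r0 rP]; apply/nbhs_normcP; exists r => // h.
  by rewrite subr0 => hr; have := rP (h + w); rewrite addrK; apply.
apply: shift0.
have /nbhs_normcP[r r0 rP] := cexp_linear_approx _ d0.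
have near_log := (cvg_normcP _ _ _).1 (continuous_clog _ w0) _ r0.
have near_Re : \forall v \near w, 0 < complex.Re v.
  exact: (@cvgr_gt _ _ (nbhs w) (nbhs_filter w) _ _ (continuous_part false w) _ w0).
apply: filterS2 near_log near_Re => v vr v0.
rewrite subrK; set k := clog v - clog w in vr *.
have := rP k; rewrite subr0 => /(_ vr).
have -> : cexp k = v / w.
  apply: canRL (mulfK wn0) _.
  by rewrite -[X in _ * X](clogK w w0) -cexpD subrK clogK.
have -> : v / w - 1 - k = w^-1 * (v - w) - k by rewrite mulrBr mulVf // mulrC.
rewrite -normcN opprB => kv.
have nk : normc k <= 2 * (normc (v - w) / normc w).
  have := normcB_le (k - w^-1 * (v - w)) (w^-1 * (v - w)).
  rewrite subrK Normc.normcM Normc.normcV => h.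
  have : d * normc k <= 2^-1 * normc k by rewrite ler_wpM2r // normc_ge0.
  lra.
apply: (le_trans kv); apply: (@le_trans _ _ (d * (2 * (normc (v - w) / normc w)))).
  by rewrite ler_pM2l.
have -> : d * (2 * (normc (v - w) / normc w)) = (d * 2 / normc w) * normc (v - w).
  by field; exact: lt0r_neq0.
by rewrite ler_wpM2r ?normc_ge0 // ler_pdivrMr // -ler_pdivlMr.
Qed.

Definition cpow (s : R) (w : C) : C := cexp (s%:C * clog w).

Lemma derivable_cpow (s : R) (w : C) :
  0 < complex.Re w -> derivable (cpow s) w (1 : C).
Proof.
move=> w0; apply/derivable1_diffP.
have -> : cpow s = cexp \o (s%:C \*: clog) by [].
apply: differentiable_comp.
  by apply: differentiableZ; apply/derivable1_diffP/derivable_clog.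
by apply/derivable1_diffP/derivable_cexp.
Qed.

Lemma normc_cpow (s : R) (w : C) :
  0 < complex.Re w -> normc (cpow s w) = normc w `^ s.
Proof.
move=> w0; have nw : 0 < normc w.
  by apply: lt_le_trans w0 (le_trans (ler_norm _) (Re_le_normc w)).
rewrite normc_cexp /powR gt_eqF //; congr expR.
by rewrite /clog /= mul0r subr0.
Qed.

End complex_power.

(** * Distance from 1 to the points of a circle *)

Section circle_distance.
Local Open Scope complex_scope.
Context {R : realType}.
Local Notation C := (R[i]^o).
Local Notation normc := Normc.normc.
Implicit Types (r t x : R).

Lemma sin_mean_value x : 0 <= x -> exists2 c, 0 <= c <= x & sin x = cos c * x.
Proof.
move=> x0; have cs : {within `[0, x], continuous sin}.
  by apply: continuous_subspaceT; exact: continuous_sin.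
have [c] := MVT_segment x0 (fun y _ => is_derive_sin y) cs.
by rewrite in_itv sin0 !subr0; exists c.
Qed.

Lemma sin_le_id x : 0 <= x -> sin x <= x.
Proof.
by move=> x0; have [c _ ->] := sin_mean_value _ x0; rewrite ler_piMl // cos_le1.
Qed.

Lemma cos_half_angle t : cos t = 1 - sin (t / 2) ^+ 2 *+ 2.
Proof.
have {1}-> : t = t / 2 *+ 2 by rewrite mulr2n -splitr.
by rewrite cos_mulr2n cos2sin2 mulrnBl; ring.
Qed.

Lemma cos_ge_half x : 0 <= x <= 1 -> 2^-1 <= cos x.
Proof.
move=> /andP[x0 x1]; rewrite cos_half_angle.
have x20 : 0 <= x / 2 by rewrite divr_ge0.
have s0 : 0 <= sin (x / 2).
  by apply: sin_ge0_pi; have := @pi_ge2 R; lra.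
have := sin_le_id _ x20; nra.
Qed.

Lemma sin_ge_half_id x : 0 <= x <= 1 -> x / 2 <= sin x.
Proof.
move=> /andP[x0 x1]; have [c /andP[c0 cx] ->] := sin_mean_value _ x0.
by rewrite mulrC ler_wpM2r // cos_ge_half // c0 (le_trans cx).
Qed.

Lemma one_sub_cos_bounds t : 0 <= t <= pi -> t ^+ 2 / 32 <= 1 - cos t <= t ^+ 2 / 2.
Proof.
move=> /andP[t0 tpi]; rewrite cos_half_angle.
have pi2 := @pihalf_lt2 R.
have t20 : 0 <= t / 2 by rewrite divr_ge0.
have t4 : 0 <= t / 4 <= 1 by apply/andP; split; lra.
have h1 := sin_le_id _ t20.
have h2 : t / 8 <= sin (t / 2).
  (* The lower bounds for [sin] and [cos] hold on [0, 1], which contains [t / 4] because [pi < 4];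
     doubling the angle then reaches [t / 2]. *)
  have -> : t / 2 = t / 4 *+ 2 by rewrite -mulr_natr; field.
  rewrite sin_mulr2n; have := sin_ge_half_id _ t4; have := cos_ge_half _ t4.
  move: t4 => /andP[? ?]; nra.
by apply/andP; split; nra.
Qed.

Definition circle r t : C := (r * cos t) +i* (r * sin t).

Lemma normc_1B_circle r t :
  normc (1 - circle r t) ^+ 2 = (1 - r) ^+ 2 + 2 * r * (1 - cos t).
Proof.
have -> : 1 - circle r t = (1 - r * cos t) +i* (0 - r * sin t) by [].
rewrite /= sqr_sqrtr ?addr_ge0 ?sqr_ge0 //.
have := sin2cos2 t; rewrite sub0r sqrrN exprMn => ->; ring.
Qed.

Lemma normc_1B_circle_bounds r t : 0 < r < 1 -> 0 <= t <= pi ->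
  (1 - r + t) / 16 <= normc (1 - circle r t) <= 1 - r + t.
Proof.
move=> /andP[r0 r1] t0pi; have /andP[lb ub] := one_sub_cos_bounds _ t0pi.
have nE := normc_1B_circle r t; have n0 := normc_ge0 (1 - circle r t).
have pi2 := @pihalf_lt2 R; case/andP: t0pi => t0 tpi.
set n := normc _ in nE n0 *; set k := 1 - cos t in lb ub nE.
have d0 : 0 < 1 - r by rewrite subr_gt0.
have dt0 : 0 <= 1 - r + t by rewrite addr_ge0 // ltW.
apply/andP; split.
  rewrite -ler_sqr ?nnegrE ?divr_ge0 // nE.
  (* Here 128 is half of [16 ^+ 2], the half coming from [(x + y) ^+ 2 <= 2 * (x ^+ 2 + y ^+ 2)].
     For [r] at least 1/2 the term with [k] controls [t ^+ 2]; for smaller [r], [1 - r] is at least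
     1/2 while [t < 4]. *)
  have : (1 - r) ^+ 2 + t ^+ 2 <= 128 * ((1 - r) ^+ 2 + 2 * r * k).
    have t2 : 0 <= t ^+ 2 by exact: sqr_ge0.
    have k0 : 0 <= k by lra.
    have [r2|r2] := leP 2^-1 r.
      have : 0 <= (r - 2^-1) * k by rewrite mulr_ge0 // subr_ge0.
      have := sqr_ge0 (1 - r); lra.
    have : 0 <= r * k by rewrite mulr_ge0 // ltW.
    have : (2^-1) ^+ 2 <= (1 - r) ^+ 2 by rewrite ler_sqr ?nnegrE ?invr_ge0; lra.
    have : t ^+ 2 <= 4 ^+ 2 by rewrite ler_sqr ?nnegrE //; lra.
    lra.
  have := sqr_ge0 (1 - r - t); rewrite !expr2; lra.
rewrite -ler_sqr ?nnegrE // nE.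
have : r * k <= t ^+ 2 / 2 by have := sqr_ge0 t; nra.
have : 0 <= (1 - r) * t by rewrite mulr_ge0 // ltW.
rewrite !expr2; lra.
Qed.

Lemma normc_1B_circle_sym r t :
  normc (1 - circle r (2 * pi - t)) = normc (1 - circle r t).
Proof.
have eq2 : normc (1 - circle r (2 * pi - t)) ^+ 2 = normc (1 - circle r t) ^+ 2.
  rewrite !normc_1B_circle cosB [2 * pi]mulr_natl cos2pi sin2pi.
  by rewrite mul1r mul0r addr0.
by apply/eqP; rewrite -(@eqrXn2 _ 2) ?normc_ge0 // eq2.
Qed.

End circle_distance.

(** ** Singular functions in Hardy spaces *)

Section hardy_space.
Local Open Scope complex_scope.
Context {R : realType}.
Local Notation C := (R[i]^o).
Local Notation normc := Normc.normc.
Local Notation mu := (@lebesgue_measure R).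

Lemma hardy_gaugeZ (p : R) (k : C) (f : C -> C) :
  (forall z : C, normc z < 1 -> derivable f z (1 : C)) ->
  (hardy_gauge p (k *: f) <= (normc k `^ p)%:E * hardy_gauge p f)%E.
Proof.
move=> df; apply: ge_ereal_sup => _ [r /= r01 <-].
under eq_integral => t _.
  rewrite -[(k *: f) _]/(k * f _) Normc.normcM powRM ?normc_ge0 // EFinM.
  over.
rewrite ge0_integralZl_EFin ?powR_ge0 //.
- apply: lee_wpmul2l; first by rewrite lee_fin powR_ge0.
  by apply: ereal_sup_ubound; exists r.
- by move=> t _; rewrite lee_fin powR_ge0.
- by apply: measurable_funTS; exact: circle_measurable.
Qed.

Lemma lte_EFin_mul (x : R) (y : \bar R) :
  0 <= x -> (y < +oo)%E -> (x%:E * y < +oo)%E.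
Proof. by move=> x0; apply: lte_mul_pinfty; rewrite ?lee_fin. Qed.

Lemma Hardy_subspace (p : R) : 0 < p -> linear_subspace (@Hardy R p).
Proof.
move=> p0; split.
  by apply: And3 => [z _||]; [exact: derivable_cst| |rewrite hardy_gauge0].
move=> k f g [df f0 fp] [dg g0 gp].
have dkf (z : C) : normc z < 1 -> derivable (k *: f) z (1 : C).
  by move=> z1; apply: derivableZ; exact: df.
apply: And3.
- by move=> z z1; apply: derivableD; [exact: dkf|exact: dg].
- move=> z z1; rewrite -[LHS]/(k * f z + g z).
  by rewrite f0 // g0 // mulr0 addr0.
- apply: le_lt_trans (hardy_gaugeD p0 dkf dg) _.
  apply: lte_EFin_mul; first exact: powR_ge0.
  apply: lte_add_pinfty; last exact: gp.
  apply: le_lt_trans (hardy_gaugeZ p k f df) _.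
  by apply: lte_EFin_mul; [exact: powR_ge0|exact: fp].
Qed.

Definition singular (s : R) (z : C) : C :=
  if normc z < 1 then cpow (- s) (1 - z) else 0.

Lemma Re_1B_gt0 (z : C) : normc z < 1 -> 0 < complex.Re (1 - z).
Proof.
case: z => x y z1; rewrite -[complex.Re _]/(1 - x) subr_gt0.
by apply: le_lt_trans z1; apply: le_trans (Re_le_normc (x +i* y)); exact: ler_norm.
Qed.

Lemma normc_1B_gt0 (z : C) : normc z < 1 -> 0 < normc (1 - z).
Proof.
move=> /Re_1B_gt0 /lt_le_trans; apply.
exact: le_trans (ler_norm _) (Re_le_normc _).
Qed.

Lemma normc_singular s (z : C) : normc z < 1 ->
  normc (singular s z) = normc (1 - z) `^ (- s).
Proof. by move=> z1; rewrite /singular z1 normc_cpow // Re_1B_gt0. Qed.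

Lemma derivable_singular s (z : C) : normc z < 1 -> derivable (singular s) z (1 : C).
Proof.
move=> z1; apply: (@near_eq_derivable _ _ _ (cpow (- s) \o (fun w : C => 1 - w))).
- apply/nbhs_normcP; exists (1 - normc z); first by rewrite subr_gt0.
  move=> w wz; rewrite /singular /= ifT // -(subrK z w).
  by apply: le_lt_trans (normcB_le _ _) _; rewrite -ltrBrDr.
- apply/derivable1_diffP; apply: differentiable_comp.
    by apply: differentiableB.
  by apply/derivable1_diffP/derivable_cpow/Re_1B_gt0.
Qed.

Lemma circle_in_disc (r t : R) : 0 < r < 1 -> normc (circle r t) < 1.
Proof. by move=> /andP[r0 r1]; rewrite normc_circle. Qed.

Lemma ler_powRN (a x y : R) : 0 <= a -> 0 < x -> x <= y -> y `^ (- a) <= x `^ (- a).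
Proof.
move=> a0 x0 xy; rewrite !powRN lef_pV2 ?posrE ?powR_gt0 ?(lt_le_trans x0) //.
by apply: ge0_ler_powR; rewrite ?nnegrE // ltW // (lt_le_trans x0).
Qed.

(** Both ends of [0, 2 pi] parametrize the point 1, hence the two terms. As [d > 0] the integrand
    has an explicit antiderivative on the closed interval, and [a < 1] makes the bound independent
    of [d]. *)
Lemma integral_powR_translates (a d : R) : 0 < a < 1 -> 0 < d <= 1 ->
  (\int[mu]_(t in `[0%R, (2 * pi)%R])
     ((d + t) `^ (- a) + (d + (2 * pi - t)) `^ (- a))%:E
   <= ((2 * 9 `^ (1 - a)) / (1 - a))%:E)%E.
Proof.
move=> /andP[a0 a1] /andP[d0 d1].
have pi2 := @pihalf_lt2 R; have pige2 := @pi_ge2 R.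
pose P : R -> R := (1 - a)^-1 \*: (fun x => x `^ (1 - a)).
have dP (x : R) : 0 < x -> is_derive x 1 P (x `^ (- a)).
  move=> x0; have h := is_deriveZ (1 - a)^-1 (is_derive1_powR (1 - a) x0).
  apply: is_derive_eq h _.
  by rewrite addrAC subrr add0r /GRing.scale /= mulrA mulVf ?mul1r // gt_eqF ?subr_gt0.
pose F : R -> R := (P \o (cst d + id)) - (P \o (cst d + (cst (2 * pi) - id))).
have dF (t : R) : 0 <= t <= 2 * pi ->
    is_derive t 1 F ((d + t) `^ (- a) + (d + (2 * pi - t)) `^ (- a)).
  move=> /andP[t0 t2pi].
  have dP1 : is_derive t 1 (P \o (cst d + id)) ((d + t) `^ (- a)).
    have h : is_derive ((cst d + id : R -> R) t) 1 P ((d + t) `^ (- a)).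
      by apply: dP; rewrite ltr_pwDl.
    have dA : is_derive t 1 (cst d + id : R -> R) 1.
      have dD := is_deriveD (is_derive_cst d t 1) (is_derive_id t 1).
      by apply: is_derive_eq dD _; rewrite add0r.
    by apply: is_derive_eq (is_derive1_comp h dA) _; rewrite mulr1.
  have dP2 : is_derive t 1 (P \o (cst d + (cst (2 * pi) - id)))
      (- (d + (2 * pi - t)) `^ (- a)).
    have h : is_derive ((cst d + (cst (2 * pi) - id) : R -> R) t) 1 P
        ((d + (2 * pi - t)) `^ (- a)).
      by apply: dP; rewrite ltr_pwDl // subr_ge0.
    have dA : is_derive t 1 (cst d + (cst (2 * pi) - id) : R -> R) (-1).
      have dB := is_deriveB (is_derive_cst (2 * pi) t 1) (is_derive_id t 1).
      by apply: is_derive_eq (is_deriveD (is_derive_cst d t 1) dB) _; rewrite !add0r.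
    by apply: is_derive_eq (is_derive1_comp h dA) _; rewrite mulrN1.
  by apply: is_derive_eq (is_deriveB dP1 dP2) _; rewrite opprK.
have cF (t : R) : 0 <= t <= 2 * pi -> {for t, continuous F}.
  move=> /dF [dFt _]; apply: differentiable_continuous.
  exact/derivable1_diffP.
have pi20 : 0 < 2 * pi :> R by lra.
have cpow (y : R) : 0 < y -> {for y, continuous (fun x : R => x `^ (- a))}.
  move=> y0; apply: differentiable_continuous; apply/derivable1_diffP.
  by have [] := is_derive1_powR (- a) y0.
rewrite (continuous_FTC2 pi20 _ _ _ (F := F)).
- rewrite -EFinB lee_fin.
  have -> : F (2 * pi) - F 0 = 2 * P (d + 2 * pi) - 2 * P d.
    rewrite -[F (2 * pi)]/(P (d + 2 * pi) - P (d + (2 * pi - 2 * pi))).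
    rewrite -[F 0]/(P (d + 0) - P (d + (2 * pi - 0))) subrr subr0 addr0; ring.
  have Pd : 0 <= P d by rewrite mulr_ge0 ?powR_ge0 // invr_ge0 subr_ge0 ltW.
  (* The 9 bounds [d + 2 * pi], as [d <= 1] and [pi < 4]. *)
  have : P (d + 2 * pi) <= 9 `^ (1 - a) / (1 - a).
    rewrite [leRHS]mulrC ler_pM2l ?invr_gt0 ?subr_gt0 //.
    by apply: ge0_ler_powR; rewrite ?nnegrE; lra.
  rewrite -mulrA; lra.
- apply: continuous_in_subspaceT => t; rewrite inE /= in_itv /= => /andP[t0 t2pi].
  apply: cvgD.
    apply: (@continuous_comp _ _ _ (fun u => d + u) (fun x => x `^ (- a))).
      by apply: cvgD; [exact: cvg_cst|exact: cvg_id].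
    by apply: cpow; rewrite ltr_pwDl.
  apply: (@continuous_comp _ _ _ (fun u => d + (2 * pi - u)) (fun x => x `^ (- a))).
    by apply: cvgD; [exact: cvg_cst|apply: cvgB; [exact: cvg_cst|exact: cvg_id]].
  by apply: cpow; rewrite ltr_pwDl // subr_ge0.
- split=> [x xI||].
  + by have [] : is_derive x 1 F _ := dF x (subset_itv_oo_cc xI).
  + by apply: cvg_at_right_filter; apply: cF; rewrite lexx ltW.
  + by apply: cvg_at_left_filter; apply: cF; rewrite lexx ltW.
- move=> x xI; rewrite derive1E.
  by have [_] : is_derive x 1 F _ := dF x (subset_itv_oo_cc xI).
Qed.

Lemma hardy_gauge_singular (p s : R) : 0 < p -> 0 < s -> s < p^-1 ->
  (hardy_gauge p (singular s) < +oo)%E.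
Proof.
move=> p0 s0 sp; pose a := s * p.
have a01 : 0 < a < 1 by rewrite mulr_gt0 // -ltr_pdivlMr // div1r.
have pi2 := @pihalf_lt2 R; have pige2 := @pi_ge2 R.
apply: (@le_lt_trans _ _ ((16 `^ a)%:E * ((2 * 9 `^ (1 - a)) / (1 - a))%:E)%E);
  last first.
  by rewrite -EFinM ltry.
apply: ge_ereal_sup => _ [r /= r01 <-].
have d01 : 0 < 1 - r <= 1 by case/andP: r01 => *; lra.
have [d0 _] := andP d01.
have mpow (g : R -> R) : continuous g ->
    measurable_fun `[0%R, (2 * pi)%R] (fun t => g t `^ (- a)).
  move=> cg; apply: measurable_funTS.
  apply: (measurableT_comp (measurable_powR _)).
  exact: continuous_measurable_fun.
have msum : measurable_fun `[0%R, (2 * pi)%R] (fun t =>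
    ((1 - r + t) `^ (- a) + (1 - r + (2 * pi - t)) `^ (- a))%:E).
  apply/measurable_EFinP; apply: measurable_funD; apply: mpow => t.
    by apply: cvgD; [exact: cvg_cst|exact: cvg_id].
  by apply: cvgD; [exact: cvg_cst|apply: cvgB; [exact: cvg_cst|exact: cvg_id]].
apply: le_trans (lee_wpmul2l _ (integral_powR_translates _ _ a01 d01)); last first.
  by rewrite lee_fin powR_ge0.
rewrite -ge0_integralZl_EFin ?powR_ge0 //; last first.
  by move=> t _; rewrite lee_fin addr_ge0 ?powR_ge0.
apply: ge0_le_integral => //.
- by move=> t _; rewrite lee_fin powR_ge0.
- by apply: measurable_funTS; apply: circle_measurable => // z; exact: derivable_singular.
- by apply: measurable_funeM.
move=> t; rewrite /= in_itv /= => /andP[t0 t2pi]; rewrite -EFinM lee_fin.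
rewrite -/(circle r t) normc_singular ?circle_in_disc // -powRrM mulNr -/a.
have bound (u : R) : 0 <= u <= pi ->
    normc (1 - circle r u) `^ (- a) <= 16 `^ a * (1 - r + u) `^ (- a).
  move=> u01; have [lb _] := andP (normc_1B_circle_bounds _ _ r01 u01).
  have [u0 _] := andP u01.
  apply: le_trans (ler_powRN _ _ _ _ _ lb) _; [by case/andP: a01 => /ltW|lra|].
  rewrite powRM ?invr_ge0 //; last lra.
  by rewrite mulrC ler_wpM2r ?powR_ge0 // -powR_inv1 // -powRrM mulN1r opprK.
have [tpi|pit] := leP t pi.
  apply: le_trans (bound t _) _; first by rewrite t0.
  by rewrite ler_wpM2l ?powR_ge0 // lerDl powR_ge0.
rewrite -normc_1B_circle_sym; apply: le_trans (bound (2 * pi - t) _) _.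
  by apply/andP; split; lra.
by rewrite ler_wpM2l ?powR_ge0 // lerDr powR_ge0.
Qed.

Lemma Hardy_singular (p s : R) : 0 < p -> 0 < s -> s < p^-1 -> Hardy p (singular s).
Proof.
move=> p0 s0 sp; split; first by move=> z; exact: derivable_singular.
  by move=> z z1; rewrite /singular ltNge z1.
exact: hardy_gauge_singular.
Qed.

Lemma powR_small (k e : R) : 0 < k -> 0 < e ->
  exists2 d, 0 < d & forall x, 0 <= x <= d -> x `^ k <= e.
Proof.
move=> k0 e0; exists (e `^ k^-1); first by rewrite powR_gt0.
move=> x /andP[x0 xd]; apply: (@le_trans _ _ ((e `^ k^-1) `^ k)).
  by apply: ge0_ler_powR; rewrite ?nnegrE ?powR_ge0 // ltW.
by rewrite -powRrM mulVf ?gt_eqF // powRr1 // ltW.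
Qed.

(** The functions with such a bound form a subspace: where [normc (1 - z) <= 1], the larger of two
    exponents gives the weaker bound. The zero function gets the exponent [a]. *)
Lemma lincomb_singular_growth (a t : R) (u : C -> C) : a < t ->
  lincomb [set s | a < s < t] singular u ->
  exists2 M, 0 <= M & exists2 t', t' < t &
    forall z, normc z < 1 -> normc (1 - z) <= 1 ->
      normc (u z) <= M * normc (1 - z) `^ (- t').
Proof.
move=> at_; apply: (lincomb_sub _ _ [set u : C -> C | exists2 M, 0 <= M &
  exists2 t', t' < t & forall z, normc z < 1 -> normc (1 - z) <= 1 ->
      normc (u z) <= M * normc (1 - z) `^ (- t')]).
  split.
    exists 0 => //; exists a => // z _ _.
    by rewrite mul0r -[X in normc X]/(0 : C) Normc.normc0.
  move=> k f g [M M0 [t1 t1t fM]] [N N0 [t2 t2t gN]].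
  exists (normc k * M + N); first by rewrite addr_ge0 ?mulr_ge0 ?normc_ge0.
  exists (Num.max t1 t2); first by rewrite gt_max t1t.
  move=> z z1 dz1.
  have d01 : 0 < normc (1 - z) <= 1 by rewrite normc_1B_gt0.
  apply: (le_trans (normcB_le (k * f z) (g z))).
  rewrite Normc.normcM mulrDl -mulrA lerD //.
    rewrite ler_wpM2l ?normc_ge0 // (le_trans (fM z z1 dz1)) // ler_wpM2l //.
    by apply: ger_powR => //; rewrite lerN2 le_max lexx.
  rewrite (le_trans (gN z z1 dz1)) // ler_wpM2l //.
  by apply: ger_powR => //; rewrite lerN2 le_max lexx orbT.
move=> s /andP[_ st]; exists 1 => //; exists s => // z z1 _.
by rewrite mul1r normc_singular.
Qed.

(** Factor out [x]^ (- t)[: what remains of the second term is]M * x [^ (t - t')], which tends to 0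
    with [x]. *)
Lemma normc_ge_dominant (c t M t' : R) : 0 < c -> 0 <= M -> t' < t ->
  exists2 e, 0 < e & forall x, 0 < x <= e ->
    c / 2 * x `^ (- t) <= c * x `^ (- t) - M * x `^ (- t').
Proof.
move=> c0 M0 tt; have cM0 : 0 < c / (2 * (M + 1)).
  by rewrite divr_gt0 // mulr_gt0 // ltr_pwDr.
have [|e e0 he] := powR_small (t - t') _ _ cM0; first by rewrite subr_gt0.
exists e => // x /andP[x0 xe].
have xtt : x `^ (- t') = x `^ (t - t') * x `^ (- t).
  by rewrite -powRD ?(gt_eqF x0) ?implybT //; congr (_ `^ _); ring.
have xt0 := powR_ge0 x (- t).
have Mx : M * x `^ (t - t') <= c / 2.
  apply: (@le_trans _ _ ((M + 1) * (c / (2 * (M + 1))))).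
    rewrite ler_pM ?powR_ge0 ?lerDl //; apply: he; by rewrite ltW.
  by rewrite le_eqVlt; apply/orP; left; apply/eqP; field; rewrite gt_eqF // ltr_pwDr.
rewrite xtt mulrA; have := ler_wpM2r xt0 Mx; lra.
Qed.

(* On the circle of radius [1 - d], the points of argument in [0, d] are within
   [2 * d] of [1]. *)
Lemma hardy_gauge_lower_bound (q t k d e : R) (f : C -> C) :
  0 < q -> 0 <= t -> 0 <= k -> 0 < d < 1 -> 2 * d <= e ->
  (forall z : C, normc z < 1 -> derivable f z (1 : C)) ->
  (forall z : C, normc z < 1 -> normc (1 - z) <= e ->
     k * normc (1 - z) `^ (- t) <= normc (f z)) ->
  (((k * (2 * d) `^ (- t)) `^ q * d)%:E <= hardy_gauge q f)%E.
Proof.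
move=> q0 t0 k0 /andP[d0 d1] de df fk.
have pige2 := @pi_ge2 R.
have r01 : 0 < 1 - d < 1 by apply/andP; split; lra.
apply: (@le_trans _ _ (\int[mu]_(u in `[0%R, (2 * pi)%R])
    (normc (f (circle (1 - d) u)) `^ q)%:E)%E); last first.
  by apply: ereal_sup_ubound; exists (1 - d).
have mf D : measurable_fun D (EFin \o (fun u : R => normc (f (circle (1 - d) u)) `^ q)).
  by apply: measurable_funTS; exact: circle_measurable.
apply: (@le_trans _ _ (\int[mu]_(u in `[0%R, d])
    (normc (f (circle (1 - d) u)) `^ q)%:E)%E); last first.
  apply: ge0_subset_integral => //; first exact: mf.
    by move=> u _; rewrite lee_fin powR_ge0.
  by apply: subset_itvl; rewrite bnd_simp; lra.
have -> : ((k * (2 * d) `^ (- t)) `^ q * d)%:E =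
    (\int[mu]_(u in `[0%R, d]) (cst ((k * (2 * d) `^ (- t)) `^ q)%:E) u)%E.
  rewrite integral_cst //= lebesgue_measure_itv /= lte_fin d0.
  by rewrite -EFinB subr0 -EFinM.
apply: ge0_le_integral => //; [by move=> u _; rewrite lee_fin powR_ge0|exact: mf|].
move=> u; rewrite /= in_itv /= => /andP[u0 ud]; rewrite lee_fin.
have u0pi : 0 <= u <= pi by apply/andP; split; lra.
have /andP[_ ub] := normc_1B_circle_bounds _ _ r01 u0pi.
have z1 := circle_in_disc _ u r01.
have ub2 : normc (1 - circle (1 - d) u) <= 2 * d by lra.
apply: (ge0_ler_powR (ltW q0)); rewrite ?nnegrE ?mulr_ge0 ?powR_ge0 ?normc_ge0 //.
apply: le_trans (fk _ z1 (le_trans ub2 de)).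
by rewrite ler_wpM2l // ler_powRN // normc_1B_gt0.
Qed.

Lemma hardy_no_leading_term (q b : R) : 0 < q ->
  no_leading_term singular q^-1 b (@Hardy R q).
Proof.
move=> q0 t c u /andP[qt tb] ut Hf; apply/eqP; apply: contraPT Hf => c0 [df _ fq].
have tq : 0 < t * q - 1 by rewrite subr_gt0 -ltr_pdivrMr // div1r.
have t0 : 0 < t by apply: lt_trans qt; rewrite invr_gt0.
have nc : 0 < normc c by exact: normc_gt0.
have [M M0 [t' t't uM]] := lincomb_singular_growth _ _ _ qt ut.
have [e0 e00 he0] := normc_ge_dominant _ _ _ _ nc M0 t't.
pose k := normc c / 2; have k0 : 0 < k by rewrite divr_gt0.
pose e := Num.min e0 1; have e_gt0 : 0 < e by rewrite lt_min e00 ltr01.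
have fk (z : C) : normc z < 1 -> normc (1 - z) <= e ->
    k * normc (1 - z) `^ (- t) <= normc ((c *: singular t + u) z).
  move=> z1; rewrite le_min => /andP[ze0 dz1].
  have := he0 (normc (1 - z)); rewrite normc_1B_gt0 // => /(_ ze0).
  move=> /le_trans; apply; rewrite lerBlDr.
  have := normcB_le ((c *: singular t + u) z) (- u z).
  rewrite normcN -[(c *: singular t + u) z]/(c * singular t z + u z) addrK.
  rewrite Normc.normcM normc_singular // => /le_trans; apply.
  by rewrite lerD2l uM.
pose G := fine (hardy_gauge q (c *: singular t + u)).
have GE : hardy_gauge q (c *: singular t + u) = G%:E.
  by rewrite fineK // ge0_fin_numE // hardy_gauge_ge0.
have G0 : 0 <= G by rewrite fine_ge0 // hardy_gauge_ge0.
pose K := (k * 2 `^ (- t)) `^ q; have K0 : 0 < K.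
  by rewrite powR_gt0 // mulr_gt0 ?powR_gt0.
have [|d1 d10 hd1] := powR_small _ (K / (G + 1)) tq.
  by rewrite divr_gt0 // ltr_pwDr.
(* The bound [e / 2] keeps the arc in the region where [fk] holds, 1/2 gives [d < 1], and [d1] makes
   the lower bound at least [G + 1]. *)
pose d := Num.min (e / 2) (Num.min 2^-1 d1).
have d0 : 0 < d by rewrite !lt_min divr_gt0 // invr_gt0 d10 ltr0n.
have de : 2 * d <= e by rewrite mulrC -ler_pdivlMr // ge_min lexx.
have d2 : d <= 2^-1 by rewrite !ge_min lexx orbT.
have dd1 : d <= d1 by rewrite !ge_min lexx !orbT.
have d01 : 0 < d < 1 by rewrite d0 (le_lt_trans d2) // invf_lt1 // ltr1n.
have := hardy_gauge_lower_bound _ _ _ _ _ _ q0 (ltW t0) (ltW k0) d01 de df fk.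
rewrite GE lee_fin; apply/negP; rewrite -ltNge.
have -> : (k * (2 * d) `^ (- t)) `^ q * d = K / d `^ (t * q - 1).
  have d_ge0 := ltW d0; have k_ge0 := ltW k0.
  have k2_ge0 : 0 <= k * 2 `^ (- t) by rewrite mulr_ge0 ?powR_ge0.
  rewrite (powRM _ _ d_ge0) // mulrA (powRM _ k2_ge0 (powR_ge0 _ _)) -/K -mulrA.
  congr (_ * _); rewrite -powRrM -powRN -[X in _ * X]powRr1 //.
  by rewrite -powRD ?(gt_eqF d0) ?implybT //; congr (_ `^ _); ring.
rewrite ltr_pdivlMr ?powR_gt0 //.
have := hd1 d; rewrite (ltW d0) dd1 => /(_ isT).
rewrite ler_pdivlMr ?ltr_pwDr //.
have := powR_gt0 (t * q - 1) d0; nra.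
Qed.

Lemma small_multiple (p d : R) (f : C -> C) : 0 < p -> 0 < d -> Hardy p f ->
  exists2 k : C, k != 0 & (hardy_gauge p (k *: f) < d%:E)%E.
Proof.
move=> p0 d0 [df _ fp]; pose G := fine (hardy_gauge p f).
have GE : hardy_gauge p f = G%:E by rewrite fineK // ge0_fin_numE // hardy_gauge_ge0.
have G0 : 0 <= G by rewrite fine_ge0 // hardy_gauge_ge0.
have [|e e0 he] := powR_small p (d / (G + 1)) p0; first by rewrite divr_gt0 // ltr_pwDr.
exists e%:C; first by rewrite -(rmorph0 (real_complex R)) (inj_eq (@complexI R)) gt_eqF.
apply: le_lt_trans (hardy_gaugeZ p e%:C f df) _; rewrite GE -EFinM lte_fin.
have -> : normc e%:C = e by rewrite /= expr0n addr0 sqrtr_sqr gtr0_norm.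
have := he e; rewrite lexx ltW // => /(_ isT).
rewrite ler_pdivlMr ?ltr_pwDr //.
have := powR_gt0 p e0; nra.
Qed.

End hardy_space.

(** * Construction of the dense subspace *)

Theorem theorem9 (R : realType) (p q : R) (p_gt0 : 0 < p) (p_lt_q : p < q) :
  exists V : {pred (R[i]^o -> R[i]^o)},
    [/\ GRing.submod_closed V,
        [set` V] `<=` (Hardy p `\` Hardy q) `|` [set 0]
      & dense [set f : hardy_space p | val f \in V]].
Proof.
have q_gt0 : 0 < q := lt_trans p_gt0 p_lt_q.
set a := q^-1; set b := p^-1.
have a_gt0 : 0 < a by rewrite invr_gt0.
have ab : a < b by rewrite ltf_pV2.
have subp := Hardy_subspace p p_gt0.
have [Z [subZ qZ indZ decZ]] := transversal_exists _ _ _ _ ab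
  (Hardy_subspace q q_gt0) (hardy_no_leading_term q b q_gt0).
have [rho rhoP] := hardy_enumeration p a b ab.
(* The default 0 keeps every [base t] in H^p and in [span_below singular a Z t], whatever [rho t]
   is. *)
pose base t : R[i]^o -> R[i]^o :=
  if `[< Hardy p (rho t) /\ span_below singular a Z t (rho t) >] then rho t else 0.
have baseZ t : span_below singular a Z t (base t).
  rewrite /base; case: ifPn => [/asboolP[]//|_].
  exact: (proj1 (span_below_subspace _ _ _ _ subZ)).
have basep t : Hardy p (base t).
  by rewrite /base; case: ifPn => [/asboolP[]//|_]; exact: (proj1 subp).
have singp t : a < t < b -> Hardy p (singular t).
  by move=> /andP[at_ tb]; apply: Hardy_singular => //; exact: lt_trans at_.
have /choice[eps epsP] : forall t, exists k : R[i]^o, a < t < b ->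
    k != 0 /\ (hardy_gauge p (k *: singular t) < (b - t)%:E)%E.
  move=> t; have [tab|] := boolP (a < t < b); last by exists 0.
  have bt0 : 0 < b - t by case/andP: tab => _ tb; rewrite subr_gt0.
  by have [k k0 kt] := small_multiple p (b - t) _ p_gt0 bt0 (singp t tab); exists k.
pose gen t := base t + eps t *: singular t.
have genp t : a < t < b -> Hardy p (gen t).
  move=> tab; apply: linear_subspaceD => //; apply: linear_subspaceZ => //.
  exact: singp.
pose V := lincomb [set t | a < t < b] gen.
have subV : linear_subspace V by exact: lincomb_subspace.
exists (fun f => `[< V f >]); split.
- split; first by apply/asboolP; case: subV.
  by move=> k f g /asboolP Vf /asboolP Vg; apply/asboolP; apply: (proj2 subV).
- move=> f /asboolP Vf; have [f0|f0] := pselect (f = 0); first by right.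
  left; split; first exact: (lincomb_sub _ _ _ subp genp).
  move=> qf; apply: f0.
  apply: (perturbed_lincomb_trivial singular a b Z base eps f) => //; last exact: qZ.
  by move=> t /epsP[].
- move=> O [f Of] /(_ f Of)[e e0 eO].
  have pf : Hardy p (val f) := set_valP f.
  have [h hb hdec] := decZ (val f).
  (* Being above [h] gives [base t = val f]; being above [b - e] makes the perturbation, of gauge
     below [b - t], smaller than [e]. *)
  have [|t [tab]] := rhoP (val f) (Num.max h (b - e)) pf.
    by rewrite gt_max hb ltrBlDr ltrDl.
  rewrite gt_max => /andP[ht bet] rhot.
  have baseE : base t = val f.
    by rewrite /base rhot ifT //; apply/asboolP; split=> //; exact: hdec.
  exists (exist _ (gen t) (mem_set (genp t tab))); split.
    apply: eO; rewrite /hardy_ball /= /gen baseE addrC addKr.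
    have [_ /lt_trans] := epsP t tab; apply.
    by rewrite lte_fin ltrBlDr -ltrBlDl.
  by apply/asboolP; exact: (lincomb_gen _ gen t tab).
Qed.
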